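(* Let $n\ge 1$, $h_1,\dots,h_n\in\mathcal H^{\rm BV}$ and $X\in L^\infty$. Suppose that $h_i(1)\neq 0$ for some $i\in[n]$. Then an allocation $(X_1,\dots,X_n)\in\mathbb A_n(X)$ is Pareto optimal in $\mathbb A_n(X)$ (for the preferences $\rho_{h_1},\dots,\rho_{h_n}$) if and only if $$\sum_{i=1}^n \rho_{\tilde h_i}(X_i)=\mathop{\square}_{i=1}^n\rho_{\tilde h_i}(X),$$ where $\tilde h_i = h_i/|h_i(1)|$ if $h_i(1)\ne 0$ and $\tilde h_i=h_i$ if $h_i(1)=0$.
   Context: $(\Omega,\mathcal F,\mathbb P)$ is an atomless probability space; a.s. equal random variables are identified; $L^\infty$ is the set of essentially bounded random variables; $[n]=\{1,\dots,n\}$. $\mathcal H^{\rm BV}$ is the set of functions $h:[0,1]\to\mathbb R$ of bounded variation with $h(0)=0$. For $h\in\mathcal H^{\rm BV}$, the distortion riskmetric $\rho_h:L^\infty\to\mathbb R$ is $$\rho_h(X)=\int_0^\infty h(\mathbb P(X>x))\,dx+\int_{-\infty}^0\big(h(\mathbb P(X>x))-h(1)\big)\,dx .$$ Allocations: $\mathbb A_n(X)=\{(X_1,\dots,X_n)\in (L^\infty)^n:\sum_{i=1}^nX_i=X\}$. Inf-convolution: $\mathop{\square}_{i=1}^n\rho_{h_i}(X)=\inf\{\sum_{i=1}^n\rho_{h_i}(X_i):(X_1,\dots,X_n)\in\mathbb A_n(X)\}\in[-\infty,\infty)$. $(X_1,\dots,X_n)\in\mathbb A_n(X)$ is Pareto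 optimal in $\mathbb A_n(X)$ if for any $(Y_1,\dots,Y_n)\in\mathbb A_n(X)$ with $\rho_{h_i}(Y_i)\le\rho_{h_i}(X_i)$ for all $i\in[n]$, one has $\rho_{h_i}(Y_i)=\rho_{h_i}(X_i)$ for all $i\in[n]$ (smaller values are preferred). *)

(* Defs.v *)
From HB Require Import structures.
From mathcomp Require Import all_boot all_order all_algebra.
From mathcomp Require Import all_classical all_reals all_analysis.

Set Implicit Arguments.
Unset Strict Implicit.
Unset Printing Implicit Defensive.

Import Order.TTheory GRing.Theory Num.Theory.
Import numFieldNormedType.Exports.

Local Open Scope classical_set_scope.
Local Open Scope ring_scope.

Definition atomless d (T : measurableType d) (R : realType)
    (P : probability T R) : Prop :=
  forall A, measurable A -> (0 < P A)%E ->
    exists B, [/\ measurable B, B `<=` A, (0 < P B)%E & (P B < P A)%E].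

(* Functions on [0, 1] are represented by total functions on R; all notions
   below depend only on their values on [0, 1]. *)
Definition HBV (R : realType) : set (R -> R) :=
  [set h | bounded_variation 0 1 h /\ h 0 = 0].

(* Elements of Linfty are genuine functions; almost sure identification is
   accounted for by the almost sure equality in [allocations] (riskmetrics
   depend only on the distribution). *)
Definition Linfty d (T : measurableType d) (R : realType)
    (P : probability T R) := LfunType P (leey 1).

Section riskmetric.
Context d (T : measurableType d) (R : realType) (P : probability T R).
Implicit Types (h : R -> R) (X : Linfty P).

(* [ccdf X x] is P(X > x). For h in HBV and X in Linfty both integrands are
   bounded, measurable and vanish outside a bounded set, so the two
   real-valued integrals are genuine. *)
Definition riskmetric h X : R :=
  \int[lebesgue_measure]_(x in `[0, +oo[) h (fine (ccdf (P := P) X x)) +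
  \int[lebesgue_measure]_(x in `]-oo, 0]) (h (fine (ccdf (P := P) X x)) - h 1).

Variable n : nat.
Implicit Types (hs : 'I_n -> R -> R) (Y Z : 'I_n -> Linfty P).

Definition allocations X : set ('I_n -> Linfty P) :=
  [set Y | {ae P, forall t, \sum_(i < n) Y i t = X t}].

Definition inf_convolution hs X : \bar R :=
  ereal_inf [set (\sum_(i < n) riskmetric (hs i) (Y i))%:E
            | Y in allocations X].

Definition pareto_optimal hs X : set ('I_n -> Linfty P) :=
  [set Y | allocations X Y /\
    forall Z, allocations X Z ->
      (forall i, riskmetric (hs i) (Z i) <= riskmetric (hs i) (Y i)) ->
      forall i, riskmetric (hs i) (Z i) = riskmetric (hs i) (Y i)].

End riskmetric.

Definition normalize (R : realType) (h : R -> R) : R -> R :=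
  fun x => if h 1 == 0 then h x else h x / `|h 1|.

(* Main.v *)
(* Since [rho_h (X + c) = rho_h X + c * h 1], deterministic cash transfers
   change the normalized preferences by [c * sg (h 1)]. If two agents have
   [h_i 1] of opposite signs, or one zero and one nonzero, a suitable transfer
   of a constant benefits somebody and harms nobody, so no Pareto optimum
   exists. Otherwise all [h_i 1] have the same strict sign, normalized utility
   is transferable at rate one, and Pareto optimality amounts to minimizing the
   normalized sum. The cash identity comes from translation invariance of the
   Lebesgue measure, once [rho_h X] is written as one integral over the line. *)
Require Import Defs.
From HB Require Import structures.
From mathcomp Require Import all_boot all_order all_algebra.
From mathcomp Require Import all_classical all_reals all_analysis.
From mathcomp Require Import measurable_realfun ess_sup_inf.

Import Order.TTheory GRing.Theory Num.Theory.
Import numFieldNormedType.Exports.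

Local Open Scope classical_set_scope.
Local Open Scope ring_scope.

Set Implicit Arguments.
Unset Strict Implicit.
Unset Printing Implicit Defensive.

(** * Lebesgue integrals on the real line: bounded support, translation, half-lines *)

Lemma integrable_bounded_support (R : realType) (f : R -> R) (B M : R) :
  measurable_fun setT f -> (forall x, `|f x| <= B) ->
  (forall x, M < `|x| -> f x = 0) ->
  lebesgue_measure.-integrable setT (EFin \o f).
Proof.
move=> mf fB f0.
have -> : EFin \o f = (EFin \o f) \_ `[- M, M].
  apply/funext => x; rewrite /patch mem_setE in_itv/= -ler_norml.
  by case: ltP => // /f0 /= ->.
have mI : measurable `[- M, M] by [].
have [+ _] := @integrable_mkcond _ _ _ (@lebesgue_measure R) _ (EFin \o f) mI.
apply; apply: measurable_bounded_integrable => //.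
- by rewrite /= lebesgue_measure_itv/=; case: ifP => // _; rewrite -EFinB ltry.
- exact: measurable_funS mf.
- exists B; split; first exact: num_real.
  by move=> y By x _; apply: le_trans (fB x) (ltW By).
Qed.

(** Lebesgue measure is determined by its values on half-open intervals, and the preimage []a + c, b
    + c]] of []a, b]] has the same length. *)
Lemma lebesgue_measure_translation (R : realType) (c : R) (A : set R) :
  measurable A ->
  pushforward lebesgue_measure (fun x : measurableTypeR R => x - c) A =
  lebesgue_measure A.
Proof.
pose phi : measurableTypeR R -> measurableTypeR R := fun x => x - c.
have mphi : measurable_fun setT phi by apply: measurable_funB.
pose mphi_mixin := isMeasurableFun.Build _ _ _ _ _ mphi.
pose phi_pack : {mfun _ >-> _} := HB.pack phi mphi_mixin.
move=> mA; apply/esym.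
apply: (lebesgue_measure_unique
  (mu := pushforward lebesgue_measure phi_pack)) => //=.
move=> _ [[a b]] _ <-; rewrite /pushforward.
have -> : phi @^-1` `]a, b] = `]a + c, b + c]%classic.
  by apply/seteqP; split => x; rewrite /phi /= !in_itv/= ltrBrDr lerBlDr.
rewrite !lebesgue_measure_itv/= !lte_fin ltrD2r.
by case: ifP => // _; rewrite -!EFinD opprD addrACA subrr addr0.
Qed.

(** Integrating [f (x + c)] against the image of Lebesgue measure under [x - c] gives back the
    integral of [f], and that image is Lebesgue measure itself. *)
Lemma Rintegral_translation (R : realType) (f : R -> R) (c : R) :
  lebesgue_measure.-integrable setT (EFin \o f) ->
  \int[lebesgue_measure]_x f (x + c) = \int[lebesgue_measure]_x f x.
Proof.
move=> intf.
pose phi : measurableTypeR R -> measurableTypeR R := fun x => x - c.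
have mphi : measurable_fun setT phi by apply: measurable_funB.
pose fc : measurableTypeR R -> \bar R := fun x => (f (x + c))%:E.
have mfc : measurable_fun setT fc.
  apply/measurable_EFinP.
  apply: (@measurableT_comp _ _ _ R R R f _ (fun x : R => x + c)).
    by apply/measurable_EFinP; have /measurable_int := intf.
  by apply: measurable_funD.
have fE : fc \o phi = EFin \o f.
  by apply/funext => x /=; rewrite /fc/= subrK.
have := integral_pushforward mphi mfc (mu := lebesgue_measure) (D := setT).
rewrite preimage_setT fE => /(_ intf measurableT) pushE.
congr fine; rewrite -[RHS]pushE.
apply: eq_measure_integral => A mA _.
exact/esym/lebesgue_measure_translation.
Qed.

(** Source of the cash term: adding [c] to a random variable displaces the ray on which [h 1] is
    subtracted. *)
Lemma Rintegral_indic_ray_difference (R : realType) (c : R) :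
  lebesgue_measure.-integrable setT
    (EFin \o (fun x => \1_(`]-oo, 0]) x - \1_(`]-oo, - c]) x)) /\
  \int[lebesgue_measure]_x (\1_(`]-oo, 0]) x - \1_(`]-oo, - c]) x) = c :> R.
Proof.
split.
  apply: (@integrable_bounded_support _ _ 1 `|c|).
  - exact: measurable_funB.
  - move=> x; rewrite !indicE.
    by case: (_ \in _); case: (_ \in _);
      rewrite ?subrr ?subr0 ?sub0r ?normrN ?normr0 ?normr1.
  - move=> x; rewrite !indicE !mem_setE !in_itv/= => cx.
    suff -> : (x <= 0) = (x <= - c) by rewrite subrr.
    move: cx; have [x0|x0] := lerP x 0.
      rewrite (ler0_norm x0) => cx; apply/esym; rewrite lerNr.
      exact/ltW/(le_lt_trans (ler_norm c)).
    rewrite (gtr0_norm x0) => cx; apply/esym/negbTE; rewrite -ltNge.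
    by rewrite (le_lt_trans _ cx)// -normrN ler_norm.
(* The difference is the indicator of []- c, 0]] if [c >= 0], and minus that of []0, - c]] if
   [c < 0]. *)
have [c0|c0] := lerP 0 c.
  rewrite [LHS](_ : _ = \int[lebesgue_measure]_x (\1_(`]- c, 0]) x)).
    rewrite /Rintegral integral_indic// setIT /= lebesgue_measure_itv/= lte_fin.
    rewrite oppr_lt0; move: c0; rewrite le_eqVlt => /predU1P[<-|->].
      by rewrite ltxx.
    by rewrite -EFinD /= add0r opprK.
  apply: eq_Rintegral => x _; rewrite !indicE !mem_setE !in_itv/=.
  have [xc|xc] := lerP x (- c); last by rewrite subr0.
  by rewrite (le_trans xc) ?oppr_le0// subrr.
rewrite [LHS](_ : _ = \int[lebesgue_measure]_x ((-1) * \1_(`]0, - c]) x)).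
  rewrite RintegralZl//.
    rewrite /Rintegral integral_indic// setIT /= lebesgue_measure_itv/= lte_fin.
    by rewrite oppr_gt0 c0 -EFinD /= oppr0 addr0 mulN1r opprK.
  apply: (@integrable_bounded_support _ _ 1 (- c)) => [|x|x].
  - exact: measurable_indic.
  - by rewrite indicE; case: (_ \in _); rewrite ?normr0 ?normr1.
  - rewrite indicE mem_setE in_itv/=; case: andP => // -[x0 xc].
    by rewrite gtr0_norm// ltNge xc.
apply: eq_Rintegral => x _; rewrite !indicE !mem_setE !in_itv/=.
have [x0|x0] := lerP x 0; last by rewrite /= mulN1r sub0r.
by rewrite (le_trans x0) ?oppr_ge0 1?ltW//= subrr mulr0.
Qed.

(** With [l = h 1] this merges the two integrals defining a riskmetric. The point 0 lies in both
    half-lines but has measure zero. *)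
Lemma Rintegral_half_lines (R : realType) (g : R -> R) (l : R) :
  lebesgue_measure.-integrable setT
    (EFin \o (fun x => g x - l * \1_(`]-oo, 0]) x)) ->
  \int[lebesgue_measure]_(x in `[0, +oo[) g x +
  \int[lebesgue_measure]_(x in `]-oo, 0]) (g x - l) =
  \int[lebesgue_measure]_x (g x - l * \1_(`]-oo, 0]) x).
Proof.
move=> intf; set f := fun x => _ in intf *.
have fN : {in `]-oo, 0]%classic, f =1 fun x => g x - l}.
  by move=> x x0; rewrite /f indicE x0 mulr1.
have fP : {in `]0, +oo[%classic, f =1 g}.
  move=> x; rewrite mem_setE in_itv/= andbT => x0.
  by rewrite /f indicE mem_setE in_itv/= leNgt x0 mulr0 subr0.
have intP : lebesgue_measure.-integrable `]0, +oo[ (EFin \o g).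
  have mP : measurable (`]0, +oo[%classic : set (measurableTypeR R)) by [].
  apply: (eq_integrable mP (EFin \o f)) => [x xP|/=].
    by rewrite /= fP.
  exact: integrableS intf.
have T : [set: R] = `]-oo, 0] `|` `]0, +oo[.
  by rewrite itv_setU_setT.
rewrite T Rintegral_setU//; last 2 first.
- by rewrite -T.
- exact: disjoint_rays.
rewrite addrC; congr (_ + _).
  apply: eq_Rintegral => x xN; exact/esym/fN.
rewrite -Rintegral_itv_obnd_cbnd//.
apply: eq_Rintegral => x xP; exact/esym/fP.
Qed.

(** Jordan decomposition: on [0, 1], [h] is a difference of two nondecreasing functions, which are
    Borel and bounded by means of their endpoint values. *)
Lemma bounded_variation_measurable_comp d (T : measurableType d)
    (R : realType) (h : R -> R) (F : T -> R) :
  bounded_variation 0 1 h -> measurable_fun setT F ->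
  (forall t, 0 <= F t <= 1) ->
  measurable_fun setT (h \o F) /\ exists B, forall t, `|h (F t)| <= B.
Proof.
move=> BVh mF F01.
(* Bounded variation controls [h] on [0, 1] only; clamping the argument extends the variation
   functions monotonically to the whole line. *)
pose clamp (x : R) := Num.min 1 (Num.max 0 x).
have clamp01 x : clamp x \in `[0, 1].
  by rewrite in_itv/= le_min ge_min le_max !lexx ler01.
have clamp_nd : nondecreasing_fun clamp.
  by move=> x y xy; rewrite le_min2// le_max2.
have nd (f : R -> R) : bounded_variation 0 1 f ->
    nondecreasing_fun (fine \o neg_tv 0 f \o clamp).
  move=> BVf x y xy; apply: (fine_neg_tv_nondecreasing BVf) => //.
  exact: clamp_nd.
have BVNh := bounded_variationN BVh.
(* The negative variation of [- h] is the positive variation of [h]. *)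
pose p := fine \o neg_tv 0 (\- h) \o clamp.
pose q := fine \o neg_tv 0 h \o clamp.
have hF t : h (F t) = p (F t) - q (F t).
  have FE : clamp (F t) = F t.
    by have /andP[F0 F1] := F01 t; rewrite /clamp (max_r F0) (min_r F1).
  rewrite (bounded_variation_pos_neg_tvE BVh) ?in_itv//=.
  by rewrite /p /q/= FE.
split.
  rewrite (_ : h \o F = (p \o F) \- (q \o F)); last exact/funext.
  by apply: measurable_funB; apply: measurableT_comp mF => //;
    apply: nondecreasing_measurable => //; exact: nd.
have bnd (f : R -> R) : nondecreasing_fun f ->
    forall t, `|f (F t)| <= `|f 0| + `|f 1|.
  move=> ndf t; have /andP[F0 F1] := F01 t.
  have := ndf _ _ F0; have := ndf _ _ F1.
  rewrite ler_norml => f1 f0; apply/andP; split.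
    rewrite lerNl (@le_trans _ _ (- f 0)) ?lerN2//.
    by rewrite (le_trans (ler_norm _))// normrN lerDl.
  by rewrite (le_trans f1)// (le_trans (ler_norm _))// lerDr.
exists (`|p 0| + `|p 1| + (`|q 0| + `|q 1|)) => t; rewrite hF.
rewrite (le_trans (ler_normB _ _))// lerD//; apply: bnd; exact: nd.
Qed.

(** * Riskmetrics as single integrals; scaling and cash translation *)

Section riskmetric_theory.
Context d (T : measurableType d) (R : realType) (P : probability T R).
Implicit Types (h : R -> R) (X : Linfty P).

Lemma Linfty_ae_bounded X : exists M, {ae P, forall t, `|X t| <= M}.
Proof.
have := Lfunction_finite (leey 1) X.
rewrite /finite_norm unlock/= probability_setT lte01.
exact: ess_supr_bounded.
Qed.

Lemma ccdf01 X x : 0 <= fine (ccdf (P := P) X x) <= 1.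
Proof.
rewrite fine_ge0//= -lee_fin fineK ?fin_num_measure//.
exact: probability_le1.
Qed.

Lemma ccdf_bounded X M : {ae P, forall t, `|X t| <= M} ->
  (forall x, M < x -> ccdf (P := P) X x = 0%E) /\
  (forall x, x < - M -> ccdf (P := P) X x = 1%E).
Proof.
move=> XM.
have null (i : interval R) : (forall y, y \in i -> M < `|y|) ->
    P (X @^-1` [set` i]) = 0%E.
  move=> iM; apply: measure_negligible.
    by apply: measurable_funPTI; exact: measurable_itv.
  apply: negligibleS XM => t /= it Mt.
  by have := iM _ it; rewrite ltNge Mt.
split => x xM.
  apply: (null `]x, +oo[) => y; rewrite in_itv/= andbT => xy.
  exact: lt_le_trans (lt_trans xM xy) (ler_norm y).
rewrite ccdf_1_cdf [cdf _ _](null `]-oo, x]) ?sube0// => y.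
rewrite in_itv/= => yx.
by rewrite -normrN (lt_le_trans _ (ler_norm _))// ltrNr (le_lt_trans yx).
Qed.

Lemma riskmetric_integral h X : HBV h ->
  lebesgue_measure.-integrable setT (EFin \o (fun x =>
    h (fine (ccdf (P := P) X x)) - h 1 * \1_(`]-oo, 0]) x)) /\
  riskmetric h X = \int[lebesgue_measure]_x
    (h (fine (ccdf (P := P) X x)) - h 1 * \1_(`]-oo, 0]) x).
Proof.
move=> [BVh h0].
set g := fun x => h (fine (ccdf (P := P) X x)).
have [mg [B gB]] : measurable_fun setT g /\ exists B, forall x, `|g x| <= B.
  apply: (bounded_variation_measurable_comp BVh); last exact: ccdf01.
  apply: measurableT_comp => //; exact: ccdf_measurable.
have [M /ccdf_bounded[gP gN]] := Linfty_ae_bounded X.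
suff intg : lebesgue_measure.-integrable setT
    (EFin \o (fun x => g x - h 1 * \1_(`]-oo, 0]) x)).
  by split => //; exact: Rintegral_half_lines.
apply: (@integrable_bounded_support _ _ (B + `|h 1|) (Num.max 0 M)).
- by apply: measurable_funB => //; apply: measurable_funM.
- move=> x; rewrite (le_trans (ler_normB _ _))// lerD// normrM ler_piMr//.
  by rewrite indicE; case: (_ \in _); rewrite ?normr0 ?normr1.
(* Far to the left the ccdf is 1 and the two terms cancel; far to the right it is 0 and
   [h 0 = 0]. *)
- move=> x; rewrite gt_max indicE mem_setE in_itv/= => /andP[x0 Mx].
  move: Mx; have [xle0|xgt0] := lerP x 0.
    rewrite ler0_norm// ltrNr => xM.
    by rewrite /g gN// mulr1 subrr.
  by rewrite gtr0_norm// => Mx; rewrite /g gP//= h0 mulr0 subrr.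
Qed.

Lemma riskmetricZ h X (a : R) : HBV h ->
  riskmetric (fun x => a * h x) X = a * riskmetric h X.
Proof.
move=> hh; have [inth ->] := riskmetric_integral X hh.
set f := (X in EFin \o X) in inth.
have fE : (fun x => a * h (fine (ccdf (P := P) X x)) -
    a * h 1 * \1_(`]-oo, 0]) x) = fun x => a * f x.
  by apply/funext => x; rewrite /f mulrBr mulrA.
rewrite -RintegralZl// /riskmetric Rintegral_half_lines fE//.
exact: (integrableZl measurableT a inth).
Qed.

(** Substituting [x + c] turns the ccdf of [X'] into that of [X]. Only the ray carrying [h 1] moves,
    which adds [h 1] times the integral of the ray difference, that is [c]. *)
Lemma riskmetric_translation h X X' (c : R) : HBV h ->
  (forall t, X' t = X t + c) -> riskmetric h X' = riskmetric h X + c * h 1.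
Proof.
move=> hh XX'; have [intX ->] := riskmetric_integral X hh.
have [intX' ->] := riskmetric_integral X' hh.
have [int1 int1E] := Rintegral_indic_ray_difference c.
rewrite -(Rintegral_translation c intX') mulrC -[in RHS]int1E -RintegralZl//.
rewrite -RintegralD//; last exact: (integrableZl measurableT (h 1) int1).
apply: eq_Rintegral => x _.
have -> : ccdf (P := P) X' (x + c) = ccdf (P := P) X x.
  congr (P _); apply/seteqP.
  by split => t /=; rewrite !in_itv/= !andbT XX' ltrD2r.
have -> : \1_(`]-oo, 0]) (x + c) = \1_(`]-oo, - c]) x :> R.
  by rewrite !indicE !mem_setE !in_itv/= -[- c]add0r lerBrDr.
by rewrite mulrBr addrA subrK.
Qed.

Lemma cst_in_Linfty (c : R) : cst c \in Lfun P +oo%E.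
Proof.
rewrite inE/=; apply/andP; split; rewrite inE//=.
rewrite /finite_norm unlock/= probability_setT lte01.
apply: le_lt_trans (ltry `|c|); apply/ess_supP.
exact: nearW.
Qed.

Lemma Linfty_translation X (c : R) :
  exists X' : Linfty P, forall t, X' t = X t + c.
Proof.
by exists ((X : LfunType P (leey 1)) + Lfun_Sub (leey 1) (cst_in_Linfty c)).
Qed.

End riskmetric_theory.

(** * Pareto optimality and minimality of the normalized sum *)

Section pareto.
Context d (T : measurableType d) (R : realType) (P : probability T R).
Variables (n : nat) (h : 'I_n -> R -> R).
Hypothesis hBV : forall i, HBV (h i).
Implicit Types (X : Linfty P) (Y Z : 'I_n -> Linfty P).

(** Supplies the competitors used against a Pareto optimum: zero-sum cash keeps the total at [X],
    and each cost moves by the cash identity. *)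
Lemma allocations_translation X Y (c : 'I_n -> R) :
  allocations X Y -> \sum_i c i = 0 ->
  exists2 Z, allocations X Z &
    forall i, riskmetric (h i) (Z i) = riskmetric (h i) (Y i) + c i * h i 1.
Proof.
move=> allocY c0.
have /choice[Z ZE] i := Linfty_translation (Y i) (c i).
exists Z => [|i]; last by apply: riskmetric_translation.
apply: filterS allocY => t /= <-.
by under eq_bigr do rewrite ZE; rewrite big_split/= c0 addr0.
Qed.

Lemma pareto_optimal_same_sign X Y : pareto_optimal h X Y ->
  (exists i, h i 1 != 0) ->
  exists2 s : R, s \in [:: 1; -1] & forall i, 0 < s * h i 1.
Proof.
move=> [allocY optY] [i hi].
(* Agent [k] hands the amount [c] to agent [j]. Under these signs nobody is harmed, so optimality
   forces both changes to vanish. *)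
have transfer j k (c : R) : j != k -> c * h j 1 <= 0 -> 0 <= c * h k 1 ->
    c * h j 1 = 0 /\ c * h k 1 = 0.
  move=> jk cj ck.
  pose e l := if l == j then c else if l == k then - c else 0.
  have e0 : \sum_l e l = 0.
    rewrite (bigD1 j)//= (bigD1 k) 1?eq_sym//= big1 => [|l /andP[lj lk]].
      by rewrite /e eqxx eq_sym (negPf jk) eqxx addr0 subrr.
    by rewrite /e (negPf lj) (negPf lk).
  have [Z allocZ ZE] := allocations_translation allocY e0.
  have Zle l : riskmetric (h l) (Z l) <= riskmetric (h l) (Y l).
    rewrite ZE// gerDl /e.
    have [->//|_] := eqVneq l j.
    have [->|_] := eqVneq l k; last by rewrite mul0r.
    by rewrite mulNr oppr_le0.
  have Zeq l : e l * h l 1 = 0.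
    apply: (addrI (riskmetric (h l) (Y l))).
    by rewrite -ZE// (optY _ allocZ Zle) addr0.
  split; first by have := Zeq j; rewrite /e eqxx.
  have := Zeq k; rewrite /e eq_sym (negPf jk) eqxx mulNr.
  by move/eqP; rewrite oppr_eq0 => /eqP.
exists (Num.sg (h i 1)) => [|j].
  by rewrite !inE; case: sgrP hi; rewrite ?eqxx ?orbT.
have [->|ji] := eqVneq j i; first by rewrite -normrEsg normr_gt0.
(* Otherwise [i] hands the cash [Num.sg (h i 1)] to [j]: the cost of [j] does not rise, while that
   of [i] drops by [|h i 1|], which is nonzero. *)
rewrite ltNge; apply/negP => sj.
have [] := transfer j i (Num.sg (h i 1)) ji sj.
  by rewrite -normrEsg.
by move=> _ /eqP; rewrite -normrEsg normr_eq0 (negPf hi).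
Qed.

Let k i := normalize (h i).

Lemma riskmetric_normalize i (Z : Linfty P) :
  riskmetric (k i) Z =
  (if h i 1 == 0 then 1 else `|h i 1|^-1) * riskmetric (h i) Z.
Proof.
rewrite -riskmetricZ//; congr riskmetric.
by apply/funext => x; rewrite /k /normalize; case: ifP; rewrite ?mul1r// mulrC.
Qed.

Let normalize1 i : k i 1 = (if h i 1 == 0 then 1 else `|h i 1|^-1) * h i 1.
Proof. by rewrite /k /normalize; case: ifP; rewrite ?mul1r// mulrC. Qed.

Let weight_gt0 i : 0 < (if h i 1 == 0 then 1 else `|h i 1|^-1).
Proof. by case: eqVneq => // hi; rewrite invr_gt0 normr_gt0. Qed.

Lemma ler_riskmetric_normalize i (Y Z : Linfty P) :
  (riskmetric (k i) Y <= riskmetric (k i) Z) =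
  (riskmetric (h i) Y <= riskmetric (h i) Z).
Proof. by rewrite !riskmetric_normalize ler_pM2l. Qed.

(** [Y] itself competes in the infimum, so attaining it means being a lower bound; this replaces the
    extended-real infimum by real inequalities. *)
Lemma inf_convolution_le X Y : allocations X Y ->
  (\sum_i riskmetric (k i) (Y i))%:E = inf_convolution k X <->
  forall Z, allocations X Z ->
    \sum_i riskmetric (k i) (Y i) <= \sum_i riskmetric (k i) (Z i).
Proof.
move=> allocY; split => [Yinf Z allocZ|Ymin].
  rewrite -lee_fin Yinf; by apply: ereal_inf_lbound; exists Z.
apply/eqP; rewrite eq_le; apply/andP; split.
  by apply: le_ereal_inf_tmp => _ [Z allocZ <-]; rewrite lee_fin Ymin.
by apply: ereal_inf_lbound; exists Y.
Qed.

(** Positive weights preserve each agent's ranking, so a Pareto improvement with one strict gain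
    would lower the normalized sum. *)
Lemma sum_minimal_pareto X Y : allocations X Y ->
  (forall Z, allocations X Z ->
    \sum_i riskmetric (k i) (Y i) <= \sum_i riskmetric (k i) (Z i)) ->
  pareto_optimal h X Y.
Proof.
move=> allocY Ymin; split=> // Z allocZ ZY i.
apply/eqP; rewrite eq_le ZY/= leNgt; apply/negP => ZYi.
have := Ymin _ allocZ; rewrite leNgt => /negP; apply.
rewrite (bigD1 i)//= [ltRHS](bigD1 i)//=; apply: ltr_leD.
  by rewrite ltNge ler_riskmetric_normalize -ltNge.
by apply: ler_sum => j _; rewrite ler_riskmetric_normalize.
Qed.

(* If [Z] had a smaller total, cash transfers could split the gain evenly, so
   that every agent strictly prefers the result to [Y]. *)
Lemma pareto_sum_minimal X Y : (exists i, h i 1 != 0) ->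
  pareto_optimal h X Y ->
  forall Z, allocations X Z ->
    \sum_i riskmetric (k i) (Y i) <= \sum_i riskmetric (k i) (Z i).
Proof.
move=> h1 optY; have [s s1 sh] := pareto_optimal_same_sign optY h1.
have [i0 _] := h1.
move=> Z allocZ; rewrite leNgt; apply/negP => ZY.
have ss : s * s = 1.
  by move: s1; rewrite !inE => /orP[]/eqP->; rewrite ?mulrNN mulr1.
have n0 : n%:R != 0 :> R.
  by rewrite pnatr_eq0 -lt0n (leq_ltn_trans _ (ltn_ord i0)).
have hs i : `|h i 1|^-1 * (s * h i 1) = 1.
  rewrite -[s * _]gtr0_norm// normrM.
  have -> : `|s| = 1.
    by move: s1; rewrite !inE => /orP[]/eqP->; rewrite ?normrN normr1.
  rewrite mul1r mulVf// normr_eq0.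
  by have := sh i; apply: contraTneq => ->; rewrite mulr0 ltxx.
have hn0 i : h i 1 != 0.
  by have := sh i; apply: contraTneq => ->; rewrite mulr0 ltxx.
(* All normalized preferences react to cash at the same rate [s], of absolute value 1. *)
have k1 i : k i 1 = s.
  rewrite normalize1 (negPf (hn0 i)) -[LHS]mul1r -[X in X * _]ss.
  by rewrite -mulrA [X in s * X]mulrCA hs mulr1.
pose D := \sum_i riskmetric (k i) (Z i) - \sum_i riskmetric (k i) (Y i).
(* Chosen so that the normalized cost of [i] goes from its value at [Z] to its value at [Y] plus
   [D / n]: the rate [s] cancels since [s * s = 1], and the shares of [D] make the transfers sum to
   zero. *)
pose c i := s * (riskmetric (k i) (Y i) - riskmetric (k i) (Z i) + D / n%:R).
have c0 : \sum_i c i = 0.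
  rewrite -mulr_sumr big_split/= sumrB sumr_const card_ord -[_ *+ n]mulr_natr.
  by rewrite divfK// /D addrC subrKA subrr mulr0.
have [W allocW WE] := allocations_translation allocZ c0.
have WEk i : riskmetric (k i) (W i) = riskmetric (k i) (Y i) + D / n%:R.
  rewrite riskmetric_normalize WE mulrDr -riskmetric_normalize mulrCA.
  rewrite -normalize1 k1 /c mulrAC ss mul1r.
  by rewrite addrA [_ + (_ - _)]addrC subrK.
have Dn : D / n%:R < 0.
  by rewrite pmulr_llt0 ?subr_lt0// invr_gt0 lt0r n0/=.
have [_ /(_ W allocW)] := optY.
have WY i : riskmetric (h i) (W i) <= riskmetric (h i) (Y i).
  by rewrite -ler_riskmetric_normalize WEk gerDl ltW.
move=> /(_ WY i0) WYi0.
(* Optimality makes [W] and [Y] equally costly for [i0], which forces [D / n = 0] although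
   [D < 0]. *)
have := WEk i0; rewrite !riskmetric_normalize WYi0 => /eqP.
by rewrite -subr_eq0 opprD addrA subrr add0r oppr_eq0 lt_eqF.
Qed.

End pareto.

Theorem theorem1 (d : measure_display) (T : measurableType d) (R : realType)
    (P : probability T R) (atomlessP : atomless P)
    (n : nat) (n_ge1 : (1 <= n)%N)
    (h : 'I_n -> R -> R) (hBV : forall i, HBV (h i))
    (h1_neq0 : exists i, h i 1 != 0)
    (X : Linfty P) (Y : 'I_n -> Linfty P) (allocY : allocations X Y) :
  pareto_optimal h X Y <->
  (\sum_(i < n) riskmetric (normalize (h i)) (Y i))%:E =
    inf_convolution (fun i => normalize (h i)) X.
Proof.
rewrite inf_convolution_le//; split; first exact: pareto_sum_minimal.
exact: sum_minimal_pareto.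
Qed.
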